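(* Let $(X,\delta)$ be an approach space. The following are equivalent. (1) $(X,\delta)$ satisfies Katětov–Tong's interpolation. (2) For all $A,B\subseteq X$ and all $\omega\in[0,\infty[$: if $\iota^\omega_A\le\delta^\omega_B$ pointwise on $X$, then there exists a bounded contraction $f:(X,\delta)\to([0,\infty],\delta_{d_{\mathbb E}})$ with $\iota^\omega_A\le f\le\delta^\omega_B$. (3) $(X,\delta)$ satisfies separation by Urysohn contractive maps.
   Context: A distance on a set $X$ is a function $\delta:X\times 2^X\to[0,\infty]$ such that for all $x\in X$, $A,B\subseteq X$, $\varepsilon\in[0,\infty]$: (D1) $\delta(x,\{x\})=0$; (D2) $\delta(x,\emptyset)=\infty$; (D3) $\delta(x,A\cup B)=\min\{\delta(x,A),\delta(x,B)\}$; (D4) $\delta(x,A)\le\delta(x,A^{(\varepsilon)})+\varepsilon$, where $A^{(\varepsilon)}=\{x\in X\mid\delta(x,A)\le\varepsilon\}$. The pair $(X,\delta)$ is an approach space. A map $f:(X,\delta_X)\to(Y,\delta_Y)$ between approach spaces is a contraction if $\delta_Y(f(x),f(A))\le\delta_X(x,A)$ for all $x\in X$, $A\subseteq X$. For $d:Z\times Z\to[0,\infty]$ vanishing on the diagonal and satisfying the triangle inequality, $\delta_d(z,A)=\inf_{a\in A}d(z,a)$ is the associated distance. Write $x\ominus y=(x-y)\vee0$ on $[0,\infty]$ (with $\infty\ominus\infty=0$), $d_{\mathbb P}(x,y)=x\ominus y$, $d_{\mathbb P}^-(x,y)=y\ominus x$, and $d_{\mathbb E}=d_{\mathbb P}\vee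 d_{\mathbb P}^-$ (the Euclidean metric, extended to $[0,\infty]$). On $[0,\infty]$ also let $\delta_{\mathbb P}(x,A)=x\ominus\sup A$ for $A\ne\emptyset$ and $\delta_{\mathbb P}(x,\emptyset)=\infty$. A function $X\to[0,\infty]$ is lower regular if it is a contraction $(X,\delta)\to([0,\infty],\delta_{\mathbb P})$; it is upper regular if it is bounded and a contraction $(X,\delta)\to([0,\infty],\delta_{d_{\mathbb P}^-})$. Notation: $\delta^\omega_B(x)=\min\{\delta(x,B),\omega\}$ and $\iota^\omega_A(x)=\omega\ominus\delta(x,X\setminus A)$. Katětov–Tong's interpolation: for all bounded functions $g,h:X\to[0,\infty]$ with $g\le h$, $g$ upper regular and $h$ lower regular, there exists a contraction $f:(X,\delta)\to([0,\infty],\delta_{d_{\mathbb E}})$ with $g\le f\le h$. For a real $\gamma>0$, sets $A,B\subseteq X$ are $\gamma$-separated if $A^{(\alpha)}\cap B^{(\beta)}=\emptyset$ whenever $\alpha\ge0$, $\beta\ge0$ and $\alpha+\beta<\gamma$. Separation by Urysohn contractive maps: for all $A,B\subseteq X$ and every real $\gamma>0$, whenever $A$ and $B$ are $\gamma$-separated, there exists a contraction $f:(X,\delta)\to([0,\gamma],\delta_{d_{\mathbb E}})$ with $f(a)=\gamma$ for $a\in A$ and $f(b)=0$ for $b\in B$. *)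

(* Defs.v *)
From mathcomp Require Import all_boot all_order all_algebra.
From mathcomp Require Import all_classical all_reals.
From mathcomp Require Import interval_inference ereal.

Set Implicit Arguments.
Unset Strict Implicit.
Unset Printing Implicit Defensive.

Import Order.TTheory GRing.Theory Num.Theory.

Local Open Scope classical_set_scope.
Local Open Scope ring_scope.
Local Open Scope ereal_scope.

(* Points of [0, oo] are elements of the library type {nonneg \bar R}, which
   contains +oo.  The values delta x A of a distance are kept in \bar R, with
   nonnegativity as an axiom, so that ereal_inf and ereal_sup apply directly. *)

Section ApproachSpaces.
Context {R : realType}.
Implicit Types X Y Z : Type.

Definition enlargement X (delta : X -> set X -> \bar R) (A : set X)
    (e : \bar R) : set X :=
  [set x | delta x A <= e].

Record is_distance X (delta : X -> set X -> \bar R) : Prop := IsDistance {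
  distance_ge0 : forall x A, 0 <= delta x A;
  distance_refl : forall x, delta x [set x] = 0;
  distance_set0 : forall x, delta x set0 = +oo;
  distance_setU : forall x A B,
    delta x (A `|` B) = mine (delta x A) (delta x B);
  distance_enlargement : forall x A e, 0 <= e ->
    delta x A <= delta x (enlargement delta A e) + e
}.

Definition contraction X Y (deltaX : X -> set X -> \bar R)
    (deltaY : Y -> set Y -> \bar R) (f : X -> Y) : Prop :=
  forall x A, deltaY (f x) (f @` A) <= deltaX x A.

Definition dist_of Z (d : Z -> Z -> \bar R) (z : Z) (A : set Z) : \bar R :=
  ereal_inf [set d z a | a in A].

(* In \bar R, +oo - +oo = -oo; hence ominus +oo +oo = 0, as required. *)
Definition ominus (x y : \bar R) : \bar R := maxe (x - y) 0.

Definition dP (x y : {nonneg \bar R}) : \bar R := ominus x%:num y%:num.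
Definition dPminus (x y : {nonneg \bar R}) : \bar R := ominus y%:num x%:num.
Definition dE (x y : {nonneg \bar R}) : \bar R := maxe (dP x y) (dPminus x y).

Definition deltaP (x : {nonneg \bar R}) (A : set {nonneg \bar R}) : \bar R :=
  if `[< A = set0 >] then +oo
  else ominus x%:num (ereal_sup [set a%:num | a in A]).

Definition fun_bounded X (f : X -> {nonneg \bar R}) : Prop :=
  exists M : R, forall x, (f x)%:num <= M%:E.

Section Properties.
Variables (X : Type) (delta : X -> set X -> \bar R).

Definition lower_regular (f : X -> {nonneg \bar R}) : Prop :=
  contraction delta deltaP f.

Definition upper_regular (f : X -> {nonneg \bar R}) : Prop :=
  fun_bounded f /\ contraction delta (dist_of dPminus) f.

Definition delta_trunc (w : R) (B : set X) (x : X) : \bar R :=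
  mine (delta x B) w%:E.

Definition iota_fun (w : R) (A : set X) (x : X) : \bar R :=
  ominus w%:E (delta x (~` A)).

Definition katetov_tong : Prop :=
  forall g h : X -> {nonneg \bar R},
    fun_bounded g -> fun_bounded h ->
    (forall x, (g x)%:num <= (h x)%:num) ->
    upper_regular g -> lower_regular h ->
    exists f : X -> {nonneg \bar R},
      contraction delta (dist_of dE) f /\
      (forall x, (g x)%:num <= (f x)%:num <= (h x)%:num).

Definition interpolation_of_distances : Prop :=
  forall (A B : set X) (w : R), (0 <= w)%R ->
    (forall x, iota_fun w A x <= delta_trunc w B x) ->
    exists f : X -> {nonneg \bar R},
      fun_bounded f /\
      contraction delta (dist_of dE) f /\
      (forall x, iota_fun w A x <= (f x)%:num <= delta_trunc w B x).

Definition gamma_separated (g : R) (A B : set X) : Prop :=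
  forall a b : \bar R, 0 <= a -> 0 <= b -> a + b < g%:E ->
    enlargement delta A a `&` enlargement delta B b = set0.

(* The interval [0, g] with the restriction of the Euclidean metric. *)
Definition segment (g : R) : Type := {x : {nonneg \bar R} | x%:num <= g%:E}.

Definition dE_segment (g : R) (x y : segment g) : \bar R :=
  dE (sval x) (sval y).

Definition urysohn_separation : Prop :=
  forall (A B : set X) (g : R), (0 < g)%R -> gamma_separated g A B ->
    exists f : X -> segment g,
      contraction delta (dist_of (@dE_segment g)) f /\
      (forall a, A a -> (sval (f a))%:num = g%:E) /\
      (forall b, B b -> (sval (f b))%:num = 0).

End Properties.
End ApproachSpaces.

(* Main.v *)
Require Import Defs.
From mathcomp Require Import all_boot all_order all_algebra.
From mathcomp Require Import all_classical all_reals.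
From mathcomp Require Import interval_inference ereal.
From mathcomp Require Import lra.

(** Interpolation gives its special case of distances because the truncated
distance to a set is lower regular, while subtracting it from a constant gives
an upper regular function.  Interpolation of distances gives Urysohn
separation because gamma-separation of A and B says exactly that the distances
of a point to A and to B add up to at least gamma, that is,
iota^gamma_(X \ A) <= delta^gamma_B; a function squeezed between these two
equals gamma on A and 0 on B.

The substance is the step from Urysohn separation to interpolation.  All
functions involved are bounded, so everything is done with real-valued
functions, where a single condition [real_lower] suffices: upper regularity of
u is lower regularity of - u, and Euclidean contractions are the functions
that satisfy both ([contractionE]).  These contractions are closed under
finite maxima and minima, additive constants and uniform limits.

Given g <= h, fix levels l_0 < l_1 < ... with mesh e.  For l_i > l_j,
regularity of g and h makes {g >= l_i} and {h <= l_j} separated by l_i - l_j,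
so a shifted Urysohn function F_ij is at least l_i on the first set and at most
l_j on the second; for l_i <= l_j the constant l_j has both properties.  The
finite max-min of the F_ij is then a contraction that lies between g - e and
h + e ([approximate_insertion]).

To remove the error, the approximation is iterated: if f_n is an insertion up
to e_n, approximate insertion is applied to max(g, f_n - e_n) and
min(h, f_n + e_n), which are again upper and lower regular.  This yields an
insertion f_(n+1) with the smaller error e_(n+1) and close to f_n, so with
e_n = 2^-n the f_n converge uniformly to an exact insertion
([real_insertion]). *)

Set Implicit Arguments.
Unset Strict Implicit.
Unset Printing Implicit Defensive.

Import Order.TTheory GRing.Theory Num.Theory.

Local Open Scope classical_set_scope.
Local Open Scope ring_scope.

(** * Elementary properties of distances *)

Section DistanceFacts.
Context {R : realType} {X : Type} {delta : X -> set X -> \bar R}.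
Hypothesis Hdelta : is_distance delta.

Lemma distance_antitone x A B : A `<=` B -> (delta x B <= delta x A)%E.
Proof.
move=> AB; rewrite -(setUidr AB) (distance_setU Hdelta).
by rewrite ge_min lexx.
Qed.

Lemma distance_mem x A : A x -> delta x A = 0%E.
Proof.
move=> Ax; apply/eqP; rewrite eq_le (distance_ge0 Hdelta) andbT.
rewrite -(distance_refl Hdelta x).
by apply: distance_antitone => _ ->.
Qed.

(** The two distances themselves are admissible radii, and a point always lies
in the enlargement of a set by its own distance to that set. *)
Lemma distance_separated w A B x : gamma_separated delta w A B ->
  (w%:E <= delta x A + delta x B)%E.
Proof.
move=> sep; rewrite leNgt; apply/negP => lt_w.
have /seteqP[+ _] :=
  sep _ _ (distance_ge0 Hdelta x A) (distance_ge0 Hdelta x B) lt_w.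
by apply; split; exact: lexx.
Qed.

End DistanceFacts.

(** * Real-valued regular functions and contractions *)

Section RealValued.
Context {R : realType} {X : Type}.
Variable delta : X -> set X -> \bar R.
Implicit Types (f g h : X -> R) (x : X) (A B : set X).

(** This is f x - sup f(A) <= delta(x, A) with the supremum replaced by an
arbitrary upper bound r, so that neither its existence nor the case of an
empty A has to be discussed. *)
Definition real_lower f : Prop := forall x A r,
  (forall a, A a -> f a <= r) -> ((f x - r)%:E <= delta x A)%E.

(** Negation exchanges upper and lower regularity; the second conjunct is the
regularity that makes f a contraction for d_P^-. *)
Definition real_contraction f : Prop :=
  real_lower f /\ real_lower (fun x => - f x).

Hypothesis Hdelta : is_distance delta.

Lemma real_lower_max f g : real_lower f -> real_lower g ->
  real_lower (fun x => Num.max (f x) (g x)).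
Proof.
move=> lf lg x A r ub; case: (leP (f x) (g x)) => _.
  by apply: lg => a /ub; rewrite ge_max => /andP[].
by apply: lf => a /ub; rewrite ge_max => /andP[].
Qed.

(** Below r, the minimum splits A into the part where f is below r and the part
where g is; the union axiom of distances reduces the bound to these parts. *)
Lemma real_lower_min f g : real_lower f -> real_lower g ->
  real_lower (fun x => Num.min (f x) (g x)).
Proof.
move=> lf lg x A r ub.
have -> : A = (A `&` [set a | f a <= r]) `|` (A `&` [set a | g a <= r]).
  rewrite -setIUr; apply/esym/setIidPl => a /ub.
  by rewrite ge_min => /orP[]; [left|right].
rewrite (distance_setU Hdelta) le_min; apply/andP; split.
  apply: le_trans (lf x _ r _); last by move=> a [].
  by rewrite lee_fin lerD2r ge_min lexx.
apply: le_trans (lg x _ r _); last by move=> a [].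
by rewrite lee_fin lerD2r ge_min lexx orbT.
Qed.

Lemma real_lower_cst c : real_lower (fun=> c).
Proof.
move=> x A r ub; have [->|/set0P[a Aa]] := eqVneq A set0.
  by rewrite (distance_set0 Hdelta) leey.
apply: le_trans (distance_ge0 Hdelta x A).
by rewrite lee_fin subr_le0 (ub a).
Qed.

Lemma real_lowerD f c : real_lower f -> real_lower (fun x => f x + c).
Proof.
move=> lf x A r ub; apply: le_trans (lf x A (r - c) _).
  by rewrite lee_fin; lra.
by move=> a /ub; lra.
Qed.

Lemma real_lower_limit f :
  (forall e, 0 < e -> exists2 g, real_lower g & forall x, `|f x - g x| <= e) ->
  real_lower f.
Proof.
move=> approx x A r ub; apply/lee_addgt0Pr => e e0.
have e20 : 0 < e / 2 by lra.
have [g lg fg] := approx _ e20.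
have := fg x; rewrite ler_norml => /andP[fg1 fg2].
rewrite -leeBlDr// -EFinB; apply: le_trans (lg x A (r + e / 2) _).
  by rewrite lee_fin; lra.
move=> a /ub fa; have := fg a; rewrite ler_norml => /andP[fg3 fg4]; lra.
Qed.

Lemma eq_real_lower f g : f =1 g -> real_lower f -> real_lower g.
Proof. by move=> /funext ->. Qed.

Lemma real_contractionN f : real_contraction f ->
  real_contraction (fun x => - f x).
Proof.
by move=> [lf uf]; split=> //; apply: eq_real_lower lf => x; rewrite opprK.
Qed.

Lemma real_contraction_cst c : real_contraction (fun=> c).
Proof. by split; exact: real_lower_cst. Qed.

Lemma real_contractionD f c : real_contraction f ->
  real_contraction (fun x => f x + c).
Proof.
move=> [lf uf]; split; first exact: real_lowerD.
by apply: eq_real_lower (real_lowerD (c := - c) uf) => x; rewrite opprD.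
Qed.

Lemma real_contraction_max f g : real_contraction f -> real_contraction g ->
  real_contraction (fun x => Num.max (f x) (g x)).
Proof.
move=> [lf uf] [lg ug]; split; first exact: real_lower_max.
by apply: eq_real_lower (real_lower_min uf ug) => x; rewrite oppr_max.
Qed.

Lemma real_contraction_min f g : real_contraction f -> real_contraction g ->
  real_contraction (fun x => Num.min (f x) (g x)).
Proof.
move=> cf cg; have := real_contractionN
  (real_contraction_max (real_contractionN cf) (real_contractionN cg)).
by congr real_contraction; apply/funext => x; rewrite oppr_max !opprK.
Qed.

(** The neutral value c is a default bound that enters the maximum itself. *)
Lemma real_contraction_bigmax c (I : Type) (s : seq I) (f : I -> X -> R) :
  (forall i, real_contraction (f i)) ->
  real_contraction (fun x => \big[Num.max/c]_(i <- s) f i x).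
Proof.
move=> cf; elim: s => [|i s IHs].
  by under eq_fun do rewrite big_nil; exact: real_contraction_cst.
by under eq_fun do rewrite big_cons; exact: real_contraction_max.
Qed.

Lemma real_contraction_bigmin c (I : Type) (s : seq I) (f : I -> X -> R) :
  (forall i, real_contraction (f i)) ->
  real_contraction (fun x => \big[Num.min/c]_(i <- s) f i x).
Proof.
move=> cf; elim: s => [|i s IHs].
  by under eq_fun do rewrite big_nil; exact: real_contraction_cst.
by under eq_fun do rewrite big_cons; exact: real_contraction_min.
Qed.

(** * Inserting a contraction, given Urysohn functions *)

Definition real_urysohn : Prop := forall A B c, 0 < c ->
  gamma_separated delta c A B ->
  exists f, [/\ real_contraction f, forall a, A a -> f a = c &
    forall b, B b -> f b = 0].

(** The inserted function is the max-min of the functions F_ij attached to the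
pairs of levels i * e and j * e.  At x, the largest level below g x bounds all
F_ij from below for its index i, hence also their minimum over j; dually, the
smallest level above h x bounds some F_ij from above in every row i. *)
Lemma approximate_insertion g h M e : real_urysohn ->
  real_lower (fun x => - g x) -> real_lower h ->
  (forall x, 0 <= g x) -> (forall x, g x <= h x) -> (forall x, h x <= M) ->
  0 < e ->
  exists f, real_contraction f /\ forall x, g x - e <= f x <= h x + e.
Proof.
move=> ury ug lh g0 gh hM e0.
pose lev (i : nat) : R := i%:R * e.
(* The level of index N - 1 exceeds M, so every value of h is followed by a
   level of index below N. *)
pose N := (Num.truncn (M / e)).+2.
have step i j : exists f, [/\ real_contraction f,
    forall x, lev i <= g x -> lev i <= f x &
    forall x, h x <= lev j -> f x <= lev j].
  have [ij|ji] := leP (lev i) (lev j).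
    by exists (fun=> lev j); split=> //; exact: real_contraction_cst.
  have c0 : 0 < lev i - lev j by rewrite subr_gt0.
  have sep : gamma_separated delta (lev i - lev j)
      [set x | lev i <= g x] [set x | h x <= lev j].
    move=> a b _ _ ab; apply/seteqP; split=> // x [/= xA xB].
    have gA : ((lev i - g x)%:E <= a)%E.
      apply: le_trans xA; rewrite addrC -[X in _ + X]opprK.
      by apply: ug => y /=; rewrite lerN2.
    have hB : ((h x - lev j)%:E <= b)%E by apply: le_trans xB; exact: lh.
    have := le_lt_trans (leeD gA hB) ab.
    by rewrite -EFinD lte_fin; have := gh x; lra.
  have [f [cf fA fB]] := ury _ _ _ c0 sep.
  exists (fun x => f x + lev j); split; first exact: real_contractionD.
    by move=> x /fA ->; rewrite subrK.
  by move=> x /fB ->; rewrite add0r.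
have [F HF] := choice (fun p : nat * nat => step p.1 p.2).
(* The default values do no harm: every level is at least 0 and every level of
   index below N is at most lev N. *)
pose f x := \big[Num.max/0]_(i < N)
  \big[Num.min/lev N]_(j < N) F (i : nat, j : nat) x.
have M0 x : 0 <= h x / e.
  by rewrite divr_ge0 ?(ltW e0)// (le_trans (g0 x)).
have lev_ge0 i : 0 <= lev i by rewrite mulr_ge0// ltW.
have ltN x : (Num.truncn (h x / e) < N.-1)%N.
  by rewrite ltnS le_truncn// ler_pM2r ?invr_gt0.
exists f; split.
  apply: real_contraction_bigmax => i; apply: real_contraction_bigmin => j.
  by have [] := HF (i : nat, j : nat).
move=> x; apply/andP; split.
- have gx0 : 0 <= g x / e by rewrite divr_ge0 ?(ltW e0).
  have /andP[lo hi] := truncn_itv gx0.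
  have iN : (Num.truncn (g x / e) < N)%N.
    apply: leq_ltn_trans (leqW (ltN x)).
    by rewrite le_truncn// ler_pM2r ?invr_gt0.
  set i := Num.truncn (g x / e) in lo hi iN.
  move: lo hi; rewrite ler_pdivlMr// ltr_pdivrMr// -/(lev i) => lo hi.
  apply: (@le_trans _ _ (lev i)).
    by rewrite /lev -natr1 mulrDl mul1r in hi *; lra.
  apply: le_trans (le_bigmax _ _ (Ordinal iN)).
  apply: le_bigmin => [|j _ /=].
    by rewrite ler_wpM2r ?(ltW e0)// ler_nat ltnW.
  by have [_ + _] := HF (i, j : nat); apply.
- have /andP[lo hi] := truncn_itv (M0 x).
  have jN := ltN x.
  set j := Num.truncn (h x / e) in lo hi jN.
  move: lo hi; rewrite ler_pdivlMr// ltr_pdivrMr// -/(lev j.+1) => lo hi.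
  apply: (@le_trans _ _ (lev j.+1)); last first.
    by rewrite /lev -natr1 mulrDl mul1r lerD2r.
  apply: bigmax_le => // i _.
  have jN' : (j.+1 < N)%N by [].
  apply: le_trans (bigmin_le _ (Ordinal jN') _) _ => /=.
  by have [_ _] := HF (i : nat, j.+1); apply; exact: ltW.
Qed.

(** Successive corrections are bounded by e_n + e_(n+1), with
e_n = 2^-n.  The total correction after stage n is then less than 4 e_n, so that
the intervals of radius 4 e_n around f_n are nested; the inserted function
takes at each point the supremum of their left ends. *)
Lemma real_insertion g h M : real_urysohn ->
  real_lower (fun x => - g x) -> real_lower h ->
  (forall x, 0 <= g x) -> (forall x, g x <= h x) -> (forall x, h x <= M) ->
  exists f, real_contraction f /\ forall x, g x <= f x <= h x.
Proof.
move=> ury ug lh g0 gh hM.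
pose e (n : nat) : R := 2^-1 ^+ n.
have e_gt0 n : 0 < e n by rewrite exprn_gt0// invr_gt0.
have eS n : e n = 2 * e n.+1 by rewrite /e exprS mulVKf.
pose good n f := real_contraction f /\ forall x, g x - e n <= f x <= h x + e n.
pose close n f f' := forall x, `|f' x - f x| <= e n + e n.+1.
have refine n f : exists f', good n f -> good n.+1 f' /\ close n f f'.
  have [[[lf uf] gfh]|nf] := pselect (good n f); last by exists f.
  pose g' x := Num.max (g x) (f x - e n).
  pose h' x := Num.min (h x) (f x + e n).
  have ug' : real_lower (fun x => - g' x).
    apply: eq_real_lower (real_lower_min ug (real_lowerD (c := e n) uf)) => x.
    by rewrite oppr_max opprB addrC.
  have lh' : real_lower h' := real_lower_min lh (real_lowerD (c := e n) lf).
  have g0' x : 0 <= g' x by rewrite le_max g0.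
  have gh' x : g' x <= h' x.
    have := gfh x; have := gh x; have := e_gt0 n.
    by rewrite ge_max !le_min => ? ? ?; lra.
  have hM' x : h' x <= M by rewrite ge_min hM.
  have [f' [cf' bf']] :=
    approximate_insertion ury ug' lh' g0' gh' hM' (e_gt0 n.+1).
  have bounds x : [/\ g x - e n.+1 <= f' x, f x - e n - e n.+1 <= f' x,
      f' x <= h x + e n.+1 & f' x <= f x + e n + e n.+1].
    have /andP[lo hi] := bf' x.
    have : g' x <= f' x + e n.+1 by rewrite -lerBlDr.
    have : f' x - e n.+1 <= h' x by rewrite lerBlDr.
    rewrite ge_max le_min => /andP[? ?] /andP[? ?]; split; lra.
  exists f' => _; split; first by split=> // x; have [-> _ ->] := bounds x.
  by move=> x; have [_ ? _ ?] := bounds x; rewrite ler_norml; lra.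
(* Making [refine] total in f turns dependent choice into plain choice
   followed by a recursion. *)
have [next nextP] := choice (fun p : nat * (X -> R) => refine p.1 p.2).
have [f0 f0P] := approximate_insertion ury ug lh g0 gh hM (e_gt0 0).
pose u := fix u n := if n is m.+1 then next (m, u m) else f0.
have uP n : good n (u n).
  by elim: n => [//|n IHn]; have [] := nextP (n, u n) IHn.
have uclose n : close n (u n) (u n.+1) by have [] := nextP (n, u n) (uP n).
(* Since e_n = 2 e_(n+1), a radius C e_n gives nested intervals as soon as
   C e_(n+1) >= 3 e_(n+1); C = 4 is a convenient choice. *)
pose low n x := u n x - 4 * e n; pose up n x := u n x + 4 * e n.
have lowS n x : low n x <= low n.+1 x.
  have := uclose n x; rewrite ler_norml /low => /andP[? ?].
  by have := eS n; have := e_gt0 n.+1; lra.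
have upS n x : up n.+1 x <= up n x.
  have := uclose n x; rewrite ler_norml /up => /andP[? ?].
  by have := eS n; have := e_gt0 n.+1; lra.
have lowup m n x : low m x <= up n x.
  have le_low : low m x <= low (maxn m n) x.
    by apply: (homo_leq (f := low ^~ x) lexx le_trans) => //; exact: leq_maxl.
  have le_up : up (maxn m n) x <= up n x.
    apply: (homo_leq (f := up ^~ x) (r := fun a b => b <= a) lexx) => //.
      by move=> b a c ba cb; exact: le_trans ba.
    exact: leq_maxr.
  apply: le_trans le_low (le_trans _ le_up).
  by rewrite /low /up; have := e_gt0 (maxn m n); lra.
pose f x := sup [set low n x | n in setT].
have fup n x : f x <= up n x.
  apply: ge_sup; first by exists (low 0 x), 0%N.
  by move=> _ [m _ <-]; exact: lowup.
have flow n x : low n x <= f x.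
  apply: ub_le_sup; last by exists n.
  by exists (up 0 x) => _ [m _ <-]; exact: lowup.
(* The powers of 1/2 are eventually below r since r^-1 < k + 1 <= 2^k. *)
have e_small r : 0 < r -> exists n, e n <= r.
  move=> r0; exists (Num.truncn r^-1); rewrite /e exprVn.
  rewrite invf_ple ?posrE ?exprn_gt0//; apply: le_trans (ltW (truncnS_gt _)) _.
  by rewrite -natrX ler_nat ltn_expl.
have fu n x : `|f x - u n x| <= 4 * e n.
  have := fup n x; have := flow n x.
  by rewrite ler_norml /low /up; lra.
exists f; split.
  split; apply: real_lower_limit => r r0;
    have [n en] := e_small (r / 4) ltac:(lra);
    have [[lu uu] _] := uP n.
    by exists (u n) => // x; apply: le_trans (fu n x) _; lra.
  exists (fun x => - u n x) => // x; rewrite -opprD normrN.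
  by apply: le_trans (fu n x) _; lra.
move=> x; apply/andP; split; apply/ler_addgt0Pr => r r0;
  have [n en] := e_small (r / 5) ltac:(lra);
  have [_ /(_ x) /andP[? ?]] := uP n; have := fu n x;
  rewrite ler_norml => /andP[? ?]; lra.
Qed.

End RealValued.

Local Open Scope ereal_scope.

(** * Translation to functions with values in [0, oo] *)

Section Translation.
Context {R : realType} {X : Type} {delta : X -> set X -> \bar R}.
Hypothesis Hdelta : is_distance delta.
Implicit Types (f : X -> {nonneg \bar R}) (u : X -> R).

Lemma ge0_nonneg (y : {nonneg \bar R}) : 0 <= y%:num.
Proof. by []. Qed.

(** The hypothesis says that u is bounded by u x - i on A, and lower regularity
turns this bound into one on the distance.  The infinite values of i only occur
for an empty A, where the distance is infinite too. *)
Lemma le_distance_of_real_lower u x A (i : \bar R) : real_lower delta u ->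
  0 <= i -> (forall a, A a -> i <= (u x - u a)%:E) -> i <= delta x A.
Proof.
move=> lu i0 ui; have [->|/set0P[a0 Aa0]] := eqVneq A set0.
  by rewrite (distance_set0 Hdelta) leey.
have : i \is a fin_num.
  by rewrite ge0_fin_numE//; apply: le_lt_trans (ui _ Aa0) (ltry _).
case: i i0 ui => // i _ ui _; apply: le_trans (lu x A (u x - i)%R _).
  by rewrite lee_fin; lra.
by move=> a /ui; rewrite lee_fin; lra.
Qed.

Lemma dE_real (y z : {nonneg \bar R}) (r s : R) :
  y%:num = r%:E -> z%:num = s%:E -> dE y z = `|r - s|%:E.
Proof.
move=> yr zs; rewrite /dE /dP /dPminus /ominus yr zs -!EFinB -!EFin_max.
congr (_%:E); have [rs|rs] := leP s r.
  rewrite ger0_norm ?subr_ge0//.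
  by rewrite (max_l (x := (r - s)%R)) ?(max_r (x := (s - r)%R)) ?max_l; lra.
rewrite ltr0_norm ?subr_lt0// opprB.
by rewrite (max_r (x := (r - s)%R)) ?(max_l (x := (s - r)%R)) ?max_r; lra.
Qed.

Lemma lower_regularE f u : (forall x, (f x)%:num = (u x)%:E) ->
  lower_regular delta f <-> real_lower delta u.
Proof.
move=> fu; split=> [lf x A r ub|lu x A].
  have [->|A0] := eqVneq A set0; first by rewrite (distance_set0 Hdelta) leey.
  apply: le_trans (lf x A); rewrite /deltaP asboolF; last first.
    by move=> /image_set0_set0/eqP; exact/negP.
  rewrite /ominus le_max fu EFinB leeB//.
  by apply: ge_ereal_sup => _ [_ [a Aa <-] <-]; rewrite fu lee_fin ub.
rewrite /deltaP; case: asboolP => [/image_set0_set0 ->|_].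
  by rewrite (distance_set0 Hdelta).
rewrite /ominus ge_max (distance_ge0 Hdelta) andbT.
set i := _ - _; have [i0|/ltW/le_trans->//] := leP 0 i; last first.
- exact: distance_ge0.
apply: (le_distance_of_real_lower lu) => // a Aa.
rewrite /i fu EFinB leeB// -fu.
by apply: ereal_sup_ubound; exists (f a) => //; exists a.
Qed.

Lemma upper_contractionE f u : (forall x, (f x)%:num = (u x)%:E) ->
  contraction delta (dist_of dPminus) f <->
  real_lower delta (fun x => (- u x)%R).
Proof.
move=> fu; split=> [cf x A r ub|lu x A].
  apply: le_trans (cf x A); apply: le_ereal_inf_tmp => _ [_ [a Aa <-] <-].
  rewrite /dPminus /ominus !fu le_max -EFinB lee_fin.
  by apply/orP; left; have := ub a Aa; lra.
set i := dist_of _ _ _; have [i0|/le_trans->//] := ltP 0 i; last first.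
- exact: distance_ge0.
apply: (le_distance_of_real_lower lu (ltW i0)) => a Aa.
have : i <= dPminus (f x) (f a).
  by apply: ereal_inf_lbound; exists (f a) => //; exists a.
rewrite /dPminus /ominus le_max (leNgt i 0) i0 orbF => /le_trans; apply.
by rewrite !fu -EFinB lee_fin; lra.
Qed.

(** A Euclidean contraction satisfies both one-sided conditions since each
one-sided difference is below the absolute value.  Conversely, A is split into
the points where u is below u x and those where it is above: the absolute value
is a one-sided difference on each part, and the distance to A is the minimum of
the distances to the two parts. *)
Lemma contractionE f u : (forall x, (f x)%:num = (u x)%:E) ->
  contraction delta (dist_of dE) f <-> real_contraction delta u.
Proof.
move=> fu; split=> [cf|[lu uu] x A].
  split=> x A r ub; apply: le_trans (cf x A);
    apply: le_ereal_inf_tmp => _ [_ [a Aa <-] <-];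
    rewrite (dE_real (fu x) (fu a)) lee_fin; have := ub a Aa;
    have := ler_norm (u x - u a)%R; have := ler_norm (- (u x - u a))%R;
    rewrite normrN; lra.
set i := dist_of _ _ _.
have i0 : 0 <= i.
  apply: le_ereal_inf_tmp => _ [_ [a Aa <-] <-].
  by rewrite (dE_real (fu x) (fu a)).
have iA a : A a -> i <= `|u x - u a|%:E.
  move=> Aa; rewrite -(dE_real (fu x) (fu a)).
  by apply: ereal_inf_lbound; exists (f a) => //; exists a.
have -> : A =
    (A `&` [set a | u a <= u x]%R) `|` (A `&` [set a | u x <= u a]%R).
  by rewrite -setIUr; apply/esym/setIidPl => a _; exact/orP/le_total.
rewrite (distance_setU Hdelta) le_min; apply/andP; split.
  apply: (le_distance_of_real_lower lu) => // a [/iA + ua].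
  by rewrite ger0_norm// subr_ge0.
apply: (le_distance_of_real_lower uu) => // a [/iA + ua].
by rewrite distrC ger0_norm ?subr_ge0// opprK addrC.
Qed.

Lemma contraction_segmentE c (f : X -> segment c) :
  contraction delta (dist_of (@dE_segment R c)) f <->
  contraction delta (dist_of dE) (fun x => sval (f x)).
Proof.
have E x A : dist_of (@dE_segment R c) (f x) (f @` A) =
    dist_of dE (sval (f x)) ((fun x => sval (f x)) @` A).
  by rewrite /dist_of !image_comp.
by split=> cf x A; [rewrite -E|rewrite E]; exact: cf.
Qed.

(** The absolute value makes this total; it is only applied to nonnegative
functions, for which it changes nothing ([nonneg_ofE]). *)
Definition nonneg_of (u : X -> R) (x : X) : {nonneg \bar R} := (`|u x|%:E)%:nng.

Lemma nonneg_ofE u : (forall x, 0 <= u x)%R ->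
  forall x, (nonneg_of u x)%:num = (u x)%:E.
Proof. by move=> u0 x /=; rewrite ger0_norm. Qed.

Lemma bounded_real_valued f : fun_bounded f ->
  exists M u, [/\ forall x, (f x)%:num = (u x)%:E, forall x, (0 <= u x)%R &
    forall x, (u x <= M)%R].
Proof.
move=> [M fM]; have fu x : (f x)%:num = (fine (f x)%:num)%:E.
  by rewrite fineK// ge0_fin_numE// (le_lt_trans (fM x)) ?ltry.
exists M, (fun x => fine (f x)%:num); split=> // x.
by rewrite -lee_fin -fu.
Qed.

Definition real_trunc (w : R) (B : set X) (x : X) : R :=
  fine (delta_trunc delta w B x).

Lemma real_truncE w B x : (0 <= w)%R ->
  delta_trunc delta w B x = (real_trunc w B x)%:E.
Proof.
move=> w0; rewrite /real_trunc fineK// ge0_fin_numE.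
  by rewrite (@le_lt_trans _ _ w%:E) ?ltry// ge_min lexx orbT.
by rewrite le_min (distance_ge0 Hdelta).
Qed.

Lemma real_trunc_itv w B x : (0 <= w)%R -> (0 <= real_trunc w B x <= w)%R.
Proof.
move=> w0; rewrite -!lee_fin -real_truncE// le_min (distance_ge0 Hdelta).
by rewrite lee_fin w0 ge_min lexx orbT.
Qed.

(** iota only depends on the truncated distance: w - min(d, w) is the truncated
difference of w and d, also for d = oo. *)
Lemma iota_funE w A x : (0 <= w)%R ->
  iota_fun delta w A x = (w - real_trunc w (~` A) x)%:E.
Proof.
move=> w0; have := real_truncE (~` A) x w0.
rewrite /iota_fun /ominus /delta_trunc.
have := distance_ge0 Hdelta x (~` A).
case: (delta x (~` A)) => [d d0|_|//]; last first.
  by rewrite min_r ?leey// => -[<-]; rewrite subrr /= max_r ?leNye.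
rewrite -EFin_min => -[<-]; rewrite -EFinB -EFin_max; congr (_%:E).
have [dw|/ltW wd] := leP d w; first by rewrite max_l ?subr_ge0.
by rewrite subrr max_r ?subr_le0.
Qed.

(** If the truncated distance to B is at most r < w on A, then A is contained in
the r-enlargement of B, so the enlargement axiom yields
delta(x, B) <= delta(x, A) + r. *)
Lemma real_lower_trunc w B : (0 <= w)%R -> real_lower delta (real_trunc w B).
Proof.
move=> w0 x A r ub; have [->|/set0P[a0 Aa0]] := eqVneq A set0.
  by rewrite (distance_set0 Hdelta) leey.
have r0 : (0 <= r)%R.
  by apply: le_trans (ub _ Aa0); have /andP[] := real_trunc_itv B a0 w0.
have [wr|rw] := leP w r.
  apply: le_trans (distance_ge0 Hdelta x A); rewrite lee_fin subr_le0.
  by apply: le_trans wr; have /andP[] := real_trunc_itv B x w0.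
rewrite EFinB leeBlDr// -real_truncE// ge_min; apply/orP; left.
have r0E : 0 <= r%:E by rewrite lee_fin.
apply: le_trans (distance_enlargement Hdelta x B r0E) _.
apply: leeD => //; apply: (distance_antitone Hdelta) => a Aa.
have : delta_trunc delta w B a <= r%:E by rewrite real_truncE// lee_fin ub.
by rewrite ge_min lee_fin (leNgt w) rw orbF.
Qed.

(** * The three implications *)

Lemma interpolation_of_katetov_tong :
  katetov_tong delta -> interpolation_of_distances delta.
Proof.
move=> kt A B w w0 AB.
pose g := nonneg_of (fun x => w - real_trunc w (~` A) x)%R.
pose h := nonneg_of (real_trunc w B).
have gE x : (g x)%:num = (w - real_trunc w (~` A) x)%:E.
  apply: nonneg_ofE => y; rewrite subr_ge0.
  by have /andP[] := real_trunc_itv (~` A) y w0.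
have hE x : (h x)%:num = (real_trunc w B x)%:E.
  by apply: nonneg_ofE => y; have /andP[] := real_trunc_itv B y w0.
have bg : fun_bounded g.
  exists w => x; rewrite gE lee_fin.
  by have /andP[] := real_trunc_itv (~` A) x w0; lra.
have hw x : (h x)%:num <= w%:E.
  by rewrite hE lee_fin; have /andP[] := real_trunc_itv B x w0.
have gh x : (g x)%:num <= (h x)%:num.
  by rewrite gE hE -iota_funE// -real_truncE.
have ug : upper_regular delta g.
  split=> //; apply/(upper_contractionE gE).
  have lt := real_lower_trunc (B := ~` A) w0.
  apply: eq_real_lower (real_lowerD (c := (- w)%R) lt).
  by move=> x; rewrite opprB addrC.
have lh : lower_regular delta h.
  by apply/(lower_regularE hE); exact: real_lower_trunc.
have [f [cf gfh]] := kt g h bg (ex_intro _ w hw) gh ug lh.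
exists f; split; last split=> // x.
  by exists w => x; have /andP[_ /le_trans->] := gfh x.
by rewrite iota_funE// real_truncE// -gE -hE.
Qed.

Lemma urysohn_of_interpolation :
  interpolation_of_distances delta -> urysohn_separation delta.
Proof.
move=> itp A B c c0 sep.
have AB x : iota_fun delta c (~` A) x <= delta_trunc delta c B x.
  rewrite /iota_fun /ominus setCK ge_max !le_min (distance_ge0 Hdelta).
  rewrite lee_fin (ltW c0) !andbT.
  have := distance_separated Hdelta x sep.
  have := distance_ge0 Hdelta x A.
  case: (delta x A) => [d d0 cAB|_ _|//]; last first.
    by rewrite /= !leNye.
  by rewrite leeBlDr// addeC cAB leeBlDr// -EFinD !lee_fin lerDl.
have [f [_ [cf bf]]] := itp _ _ c (ltW c0) AB.
have fc x : (f x)%:num <= c%:E.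
  by have /andP[_ /le_trans->//] := bf x; rewrite ge_min lexx orbT.
exists (fun x => exist _ (f x) (fc x)); split; first exact/contraction_segmentE.
split=> [a Aa|b Bb] /=; apply/eqP; rewrite eq_le.
  rewrite fc; have /andP[+ _] := bf a; apply: le_trans.
  by rewrite /iota_fun /ominus setCK (distance_mem Hdelta Aa) sube0 le_max lexx.
rewrite ge0_nonneg andbT; have /andP[_ /le_trans->//] := bf b.
by rewrite ge_min (distance_mem Hdelta Bb) lexx.
Qed.

Lemma real_urysohn_of_urysohn : urysohn_separation delta -> real_urysohn delta.
Proof.
move=> ury A B c c0 sep; have [f [cf [fA fB]]] := ury A B c c0 sep.
have fE x : (sval (f x))%:num = (fine (sval (f x))%:num)%:E.
  by rewrite fineK// ge0_fin_numE// (le_lt_trans (svalP (f x))) ?ltry.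
exists (fun x => fine (sval (f x))%:num); split.
- by apply/(contractionE fE)/contraction_segmentE.
- by move=> a /fA ->.
- by move=> b /fB ->.
Qed.

Lemma katetov_tong_of_urysohn : urysohn_separation delta -> katetov_tong delta.
Proof.
move=> /real_urysohn_of_urysohn ury g h bg bh gh [_ ug] lh.
have [_ [u [gu u0 _]]] := bounded_real_valued bg.
have [M [v [hv v0 vM]]] := bounded_real_valued bh.
have uv x : (u x <= v x)%R by rewrite -lee_fin -gu -hv.
have [k [ck ukv]] := real_insertion Hdelta ury
  ((upper_contractionE gu).1 ug) ((lower_regularE hv).1 lh) u0 uv vM.
have kE : forall x, (nonneg_of k x)%:num = (k x)%:E.
  by apply: nonneg_ofE => x; have /andP[/(le_trans (u0 x))] := ukv x.
exists (nonneg_of k); split; first by apply/(contractionE kE).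
by move=> x; rewrite kE gu hv !lee_fin.
Qed.

End Translation.

Theorem theorem4p3 (R : realType) (X : Type) (delta : X -> set X -> \bar R)
    (Hdelta : is_distance delta) :
  (katetov_tong delta <-> interpolation_of_distances delta) /\
  (interpolation_of_distances delta <-> urysohn_separation delta).
Proof.
have kt_itp := interpolation_of_katetov_tong Hdelta.
have itp_ury := urysohn_of_interpolation Hdelta.
have ury_kt := katetov_tong_of_urysohn Hdelta.
by split; split; auto.
Qed.
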